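(* Let $n$ be an integer with $2\le n<\aleph_0$. If the probability indices of the language are restricted within a finite set $I\subseteq\mathbb{Q}\cap[0,1]$ of rationals and there are finitely many propositional letters in the language, forming a finite nonempty set $P$, then the canonical space $\Omega_H$ of $\Sigma_H$ for $n$ agents, that is, the set of all maximally $\Sigma_H$-consistent sets of $n$-agent formulas whose propositional letters are in $P$ and whose probability indices are in $I$, has the cardinality of the continuum.
   Context: $n$-agent language: formulas are given by $\phi ::= p \mid \neg\phi \mid \phi_1\wedge\phi_2 \mid L^i_r\phi$, with $p$ a propositional letter, $i\in\{1,\dots,n\}$ an agent and $r\in\mathbb{Q}\cap[0,1]$ a probability index; $L^i_r\phi$ is read as ''agent $i$'s belief in $\phi$ is at least $r$''. A logic is a set of formulas containing all propositional tautologies and closed under modus ponens and uniform substitution. $\Sigma_H$ (for $n$ agents) is the smallest logic containing, for every agent $i$, with $L_r=L_r^i$: (A1) $L_0\phi$; (A2) $L_r\top$; (A3) $L_r(\phi\wedge\psi)\wedge L_t(\phi\wedge\neg\psi)\to L_{r+t}\phi$ for $r+t\le 1$; (A4) $\neg L_r(\phi\wedge\psi)\wedge\neg L_s(\phi\wedge\neg\psi)\to\neg L_{r+s}\phi$ for $r+s\le1$; (A5) $L_r\phi\to\neg L_s\neg\phi$ for $r+s>1$; $(4_p)$ $L_r\phi\to L_1L_r\phi$; $(5_p)$ $\neg L_r\phi\to L_1\neg L_r\phi$; and closed, for every agent $i$, under (DIS): from $\phi\leftrightarrow\psi$ infer $L_r\phi\leftrightarrow L_r\psi$; and (ARCH):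 if $\gamma\to L_s\phi$ is a theorem for all $s<r$, then $\gamma\to L_r\phi$ is a theorem. All indices are rationals in $[0,1]$. A finite set of formulas is $\Sigma_H$-consistent if the negation of its conjunction is not in $\Sigma_H$; an arbitrary set is $\Sigma_H$-consistent if all its finite subsets are; a set of formulas of a sublanguage is maximally consistent in it if it is consistent and no properly larger set of formulas of that sublanguage is.
   Formalization: The finite index set I is additionally assumed to contain a positive rational; if I is empty or {0}, every formula is equivalent to a propositional one and the canonical space has only 2^|P| elements, so the claim fails. *)

(* Defs.v *)
From Stdlib Require List.
From mathcomp Require Import all_boot all_order all_algebra.
From mathcomp Require Import boolp classical_sets functions cardinality reals.

Set Implicit Arguments.
Unset Strict Implicit.
Unset Printing Implicit Defensive.

Import Order.TTheory GRing.Theory Num.Theory.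
Local Open Scope ring_scope.
Local Open Scope classical_set_scope.

Definition pindex := {r : rat | 0 <= r <= 1}.

Definition pindex0 : pindex := exist (fun r : rat => 0 <= r <= 1) 0 isT.
Definition pindex1 : pindex := exist (fun r : rat => 0 <= r <= 1) 1 isT.

Inductive formula (n : nat) (Atom : Type) : Type :=
| Var of Atom
| Neg of formula n Atom
| And of formula n Atom & formula n Atom
| L of 'I_n & pindex & formula n Atom.

Arguments Var {n Atom} p.
Arguments Neg {n Atom} f.
Arguments And {n Atom} f g.
Arguments L {n Atom} i r f.

Section Logic.
Variables (n : nat) (Atom : Type).
Local Notation fml := (formula n Atom).
Implicit Types (p : Atom) (f g : fml) (i : 'I_n).

Definition Imp f g : fml := Neg (And f (Neg g)).
Definition Iff f g : fml := And (Imp f g) (Imp g f).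

(* The grammar has no constant for truth: Top f is f -> f, and wherever the
   constant is needed f is universally quantified. *)
Definition Top f : fml := Imp f f.

Fixpoint subst (s : Atom -> fml) f : fml :=
  match f with
  | Var p => s p
  | Neg g => Neg (subst s g)
  | And g h => And (subst s g) (subst s h)
  | L i r g => L i r (subst s g)
  end.

(* Letters and formulas L i r g are both atoms for the valuation v, so a
   tautology may contain modal subformulas. *)
Fixpoint bool_eval (v : fml -> bool) f : bool :=
  match f with
  | Var p => v (Var p)
  | Neg g => ~~ bool_eval v g
  | And g h => bool_eval v g && bool_eval v h
  | L i r g => v (L i r g)
  end.

Definition tautology f : Prop := forall v, bool_eval v f.

(* In A3 and A4 the sum of two indices is given as a third index, which is
   possible exactly when the sum is at most 1. *)
Inductive SigmaH : set fml :=
| SH_taut f : tautology f -> SigmaH f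
| SH_MP f g : SigmaH (Imp f g) -> SigmaH f -> SigmaH g
| SH_US s f : SigmaH f -> SigmaH (subst s f)
| SH_A1 i f : SigmaH (L i pindex0 f)
| SH_A2 i r f : SigmaH (L i r (Top f))
| SH_A3 i (r t u : pindex) f g : val u = val r + val t ->
    SigmaH (Imp (And (L i r (And f g)) (L i t (And f (Neg g)))) (L i u f))
| SH_A4 i (r s u : pindex) f g : val u = val r + val s ->
    SigmaH (Imp (And (Neg (L i r (And f g))) (Neg (L i s (And f (Neg g)))))
                (Neg (L i u f)))
| SH_A5 i (r s : pindex) f : 1 < val r + val s ->
    SigmaH (Imp (L i r f) (Neg (L i s (Neg f))))
| SH_4p i r f : SigmaH (Imp (L i r f) (L i pindex1 (L i r f)))
| SH_5p i r f : SigmaH (Imp (Neg (L i r f)) (L i pindex1 (Neg (L i r f))))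
| SH_DIS i r f g : SigmaH (Iff f g) -> SigmaH (Iff (L i r f) (L i r g))
| SH_ARCH i (r : pindex) f g :
    (forall s : pindex, val s < val r -> SigmaH (Imp g (L i s f))) ->
    SigmaH (Imp g (L i r f)).

(* t is the conjunction of the empty list. *)
Definition conjunction (t : fml) (s : seq fml) : fml := foldr And t s.

Definition consistent_seq (s : seq fml) : Prop :=
  forall t : fml, ~ SigmaH (Neg (conjunction (Top t) s)).

Definition consistent (G : set fml) : Prop :=
  forall s : seq fml, (forall f, List.In f s -> G f) -> consistent_seq s.

Fixpoint in_language (P : set Atom) (I : set pindex) f : Prop :=
  match f with
  | Var p => P p
  | Neg g => in_language P I g
  | And g h => in_language P I g /\ in_language P I h
  | L i r g => I r /\ in_language P I g
  end.

Definition language (P : set Atom) (I : set pindex) : set fml :=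
  [set f | in_language P I f].

Definition maximally_consistent (Lg G : set fml) : Prop :=
  [/\ G `<=` Lg, consistent G &
      forall D : set fml, D `<=` Lg -> G `<` D -> ~ consistent D].

Definition OmegaH (P : set Atom) (I : set pindex) : set (set fml) :=
  [set G | maximally_consistent (language P I) G].

End Logic.

(* Main.v *)
Require Import Defs.
From mathcomp Require Import all_boot all_order all_algebra.
From mathcomp Require Import boolp classical_sets functions cardinality reals.
From mathcomp Require Import lra.

(** Upper bound: the letters come from a finite set, so there are only countably
    many formulas in the language, and a point of the canonical space is a set
    of them.

    Lower bound: a point is constructed for every set of natural numbers.  If
    each agent's belief at each world is a Dirac measure, an agent is just an
    idempotent map [step i] on worlds: [L i r f] with [0 < r] says that [f] holds
    at [step i w], and introspection is the idempotence of [step i].  Every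
    such frame validates the axioms and rules ([SigmaH_sound]), so the formulas
    of a sublanguage true at a world of a model form a maximally consistent set
    ([theory_OmegaH]).  Already two agents can explore an infinite path: on the
    frame [nat], one moves even worlds one step forward, the other odd ones.
    With a positive index [r], the formula L L ... L p with k alternating
    agents holds at world 0 exactly when p holds at world k ([sat_zigzag]).
    As a single letter p can be true on any set of worlds, distinct sets yield
    distinct points.

    Sets of naturals are compared with the reals by Dedekind cuts in one
    direction and by ternary expansions with digits 0 and 1 in the other, and
    Cantor-Bernstein concludes. *)

Set Implicit Arguments.
Unset Strict Implicit.
Unset Printing Implicit Defensive.

Import Order.TTheory GRing.Theory Num.Theory.
Local Open Scope classical_set_scope.

(** * Dirac models *)

(** Named so that simplification does not expand the equality of rationals. *)
Definition null_index (r : pindex) : bool := (val r == 0)%R.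
Arguments null_index r : simpl never.

Section DiracModels.
Variables (n : nat) (Atom W : Type) (step : 'I_n -> W -> W).
Local Notation fml := (formula n Atom).
Implicit Types (V : Atom -> W -> bool) (f g : fml).

(** The belief of agent [i] at [w] is the Dirac measure at [step i w], so [L i r g]
    is trivial for a null index and insensitive to [r] otherwise. *)
Fixpoint sat V f (w : W) : bool :=
  match f with
  | Var p => V p w
  | Neg g => ~~ sat V g w
  | And g h => sat V g w && sat V h w
  | L i r g => null_index r || sat V g (step i w)
  end.

Lemma sat_bool_eval V f w : sat V f w = bool_eval (sat V ^~ w) f.
Proof. by elim: f => //= [f -> | f -> g ->]. Qed.

Lemma sat_subst V (s : Atom -> fml) f w :
  sat V (subst s f) w = sat (fun p => sat V (s p)) f w.
Proof.
by elim: f w => //= [f IH w|f IHf g IHg w|i r f IH w]; rewrite ?IH ?IHf ?IHg.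
Qed.

Lemma sat_imp V f g w : sat V (Imp f g) w = (sat V f w ==> sat V g w).
Proof. by rewrite /= negb_and negbK implybE. Qed.

Lemma sat_conjunction V t (s : seq fml) w :
  sat V t w -> (forall f, List.In f s -> sat V f w) ->
  sat V (conjunction t s) w.
Proof.
move=> tw; elim: s => //= f s IH H; rewrite H; last by left.
by apply: IH => g gs; apply: H; right.
Qed.

Hypothesis stepK : forall i w, step i (step i w) = step i w.

(** Validity is required in all valuations at once because of uniform
    substitution, which changes the valuation. *)
Lemma SigmaH_sound f : SigmaH f -> forall V w, sat V f w.
Proof.
elim=> {f}.
- by move=> f taut V w; rewrite sat_bool_eval.
- by move=> f g _ IHfg _ IHf V w; have := IHfg V w; rewrite sat_imp IHf.
- by move=> s f _ IH V w; rewrite sat_subst.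
- by [].
- by move=> i r f V w; rewrite /= andbN orbT.
- move=> i r t u f g rtu V w; rewrite sat_imp /=; apply/implyP.
  case: (sat V f _) => /=; first by rewrite orbT.
  by rewrite !orbF /null_index rtu => /andP[/eqP -> /eqP ->]; rewrite addr0.
- move=> i r s u f g rsu V w; rewrite sat_imp /=; apply/implyP.
  case: (sat V f _) => /=; first by case: (sat V g _); rewrite ?orbT ?andbF.
  have /andP[r_ge0 _] := valP r; have /andP[s_ge0 _] := valP s.
  by rewrite !orbF /null_index rsu paddr_eq0 // => /andP[/negPf ->].
- (* [1 < r + s] with both indices at most 1 makes both positive. *)
  move=> i r s f rs1 V w; rewrite sat_imp /=; apply/implyP.
  have /andP[_ r1] := valP r; have /andP[_ s1] := valP s.
  have -> : null_index r = false by apply/eqP => r0; lra.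
  have -> : null_index s = false by apply/eqP => s0; lra.
  by move=> /= ->.
- by move=> i r f V w; rewrite sat_imp /= stepK orbC => /=; apply/implyP => ->.
- by move=> i r f V w; rewrite sat_imp /= stepK orbC => /=; apply/implyP => ->.
- move=> i r f g _ IH V w; have := IH V (step i w).
  rewrite /Iff /= -!/(sat V (Imp _ _) _).
  by case: (sat V f _); case: (sat V g _); case: null_index.
- move=> i r f g _ IH V w; rewrite sat_imp; apply/implyP => gw /=.
  have /andP[r_ge0 r_le1] := valP r.
  have [//|r_neq0] := boolP (null_index r).
  have r_gt0 : (0 < val r)%R by rewrite lt_def r_neq0.
  (* Belief with any positive index below [r] suffices. *)
  have s01 : (0 <= val r / 2 <= 1)%R by apply/andP; split; lra.
  pose s : pindex := exist _ (val r / 2)%R s01.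
  have sE : val s = (val r / 2)%R by [].
  have s_lt : (val s < val r)%R by rewrite sE; lra.
  have := IH s s_lt V w; rewrite sat_imp gw /=.
  by have -> : null_index s = false by rewrite /null_index sE; apply/eqP; lra.
Qed.

Definition theory (Lg : set fml) V w : set fml := [set f | Lg f /\ sat V f w].

Lemma theory_consistent Lg V w : consistent (theory Lg V w).
Proof.
move=> s sT t /SigmaH_sound /(_ V w) /=; rewrite sat_conjunction //=.
  by rewrite andbN.
by move=> f /sT[].
Qed.

(** Maximality holds because truth at a world decides every formula. *)
Lemma theory_OmegaH P I V w : OmegaH P I (theory (language P I) V w).
Proof.
split; [by move=> f [] | exact: theory_consistent|].
move=> D DL [TD /nonsubset[f [Df nTf]]] Dcons.
have Lf := DL _ Df.
have DNf : D (Neg f).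
  by apply: TD; split=> //=; apply/negP => fw; apply: nTf.
apply: (Dcons [:: f; Neg f] _ f); first by move=> g /= [<-|[<-|]].
by apply: SH_taut => v /=; case: (bool_eval v f).
Qed.

End DiracModels.

(** * The alternating path *)

Section AlternatingPath.
Variables (n : nat) (n_ge2 : (2 <= n)%N) (Atom : Type).

Definition path_agent (b : bool) : 'I_n :=
  if b then Ordinal n_ge2 else Ordinal (ltnW n_ge2).

(** The path [0 -> 1 -> 2 -> ...], whose edges out of even worlds belong to the
    first agent and whose edges out of odd worlds belong to all the others; a
    world where an agent has no outgoing edge is fixed by that agent. *)
Definition path_step (i : 'I_n) (k : nat) : nat :=
  if odd k == (i != 0 :> nat) then k.+1 else k.

Lemma path_stepK i k : path_step i (path_step i k) = path_step i k.
Proof.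
rewrite /path_step; case E: (odd k == _); rewrite ?E //=.
by move: E; case: (odd k); case: (_ != _).
Qed.

Lemma path_step_agent k : path_step (path_agent (odd k)) k = k.+1.
Proof. by rewrite /path_step /path_agent; case: (odd k). Qed.

Fixpoint zigzag (r : pindex) (p : Atom) (b : bool) (k : nat) : formula n Atom :=
  if k is k'.+1 then L (path_agent b) r (zigzag r p (~~ b) k') else Var p.

Lemma zigzag_language (P : set Atom) (I : set pindex) r p b k :
  P p -> I r -> language P I (zigzag r p b k).
Proof. by move=> Pp Ir; elim: k b => //= k IH b; split=> //; apply: IH. Qed.

(** Unfolding one operator moves the evaluation one world ahead on the path and
    passes the turn to the agent that can leave that world. *)
Lemma sat_zigzag V r p m k : (0 < val r)%R ->
  sat path_step V (zigzag r p (odd m) k) m = V p (m + k).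
Proof.
move=> r_gt0; elim: k m => [|k IH] m; first by rewrite addn0.
have r_neq0 : null_index r = false by rewrite /null_index gt_eqF.
by rewrite /= r_neq0 path_step_agent -[~~ odd m]/(odd m.+1) IH addSnnS.
Qed.

End AlternatingPath.

(** * Cardinality of the canonical space *)

Lemma set_inj_card_le T U (A : set T) (B : set U) (f : T -> U) :
  set_fun A B f -> set_inj A f -> (A #<= B)%card.
Proof.
move=> fAB finj; have [g] : $|{injfun A >-> B}| by apply/injfunPex; exists f.
exact: inj_card_le.
Qed.

Lemma card_le_OmegaH n (n_ge2 : (2 <= n)%N) (Atom : Type) (P : set Atom)
    (I : set pindex) (p : Atom) (r : pindex) :
  P p -> I r -> (0 < val r)%R ->
  ([set: set nat] #<= @OmegaH n Atom P I)%card.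
Proof.
move=> Pp Ir r_gt0.
pose V (A : set nat) (_ : Atom) k := `[< A k >].
apply: (@set_inj_card_le _ _ _ _
  (fun A => theory (@path_step n) (language P I) (V A) 0)).
  by move=> A _; apply: theory_OmegaH; exact: path_stepK.
move=> A B _ _ eqAB.
have memE (C : set nat) k :
    theory (@path_step n) (language P I) (V C) 0 (zigzag n_ge2 r p false k) = C k.
  apply/propext; split=> [[_]|Ck]; last (split; first exact: zigzag_language).
    by rewrite (@sat_zigzag _ _ _ _ _ _ 0) // => /asboolP.
  by rewrite (@sat_zigzag _ _ _ _ _ _ 0) //; apply/asboolP.
by apply/funext => k; rewrite -memE eqAB memE.
Qed.

Section Encoding.
Variables (n : nat) (Atom : Type) (P : set Atom) (I : set pindex).

(** Trees with countable labels form a countable type, and rational indices and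
    numbered letters are such labels. *)
Fixpoint encode (e : Atom -> nat) (f : formula n Atom) :
    GenTree.tree (nat + 'I_n * pindex) :=
  match f with
  | Var p => GenTree.Leaf (inl (e p))
  | Neg g => GenTree.Node 0 [:: encode e g]
  | And g h => GenTree.Node 1 [:: encode e g; encode e h]
  | L i r g => GenTree.Node 2 [:: GenTree.Leaf (inr (i, r)); encode e g]
  end.

Lemma encode_inj e : set_inj P e -> set_inj (@language n Atom P I) (encode e).
Proof.
move=> einj f g; rewrite !inE.
elim: f g => [p|f IH|f IHf h IHh|i r f IH] [q|g|g k|j s g] //=.
- by move=> Pp Pq [/einj ->//]; rewrite inE.
- by move=> fL gL [/IH ->].
- by move=> [fL hL] [gL kL] [/IHf -> // /IHh ->].
- by move=> [_ fL] [_ gL] [-> -> /IH ->].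
Qed.

Lemma countable_language : countable P -> countable (@language n Atom P I).
Proof.
move=> /countable_injP[e einj]; apply/countable_injP.
exists (pickle \o encode e) => f g fL gL /= /(pcan_inj pickleK).
exact: encode_inj.
Qed.

Lemma OmegaH_card_le : countable P ->
  (@OmegaH n Atom P I #<= [set: set nat])%card.
Proof.
move=> /countable_language/countable_injP[e einj].
apply: (@set_inj_card_le _ _ _ _ (fun G => e @` G)) => // G H.
have imE (K : set (formula n Atom)) f : OmegaH P I K -> language P I f ->
    (e @` K) (e f) <-> K f.
  move=> [KL _ _] fL; split=> [[g Kg egf]|Kf]; last by exists f.
  by rewrite -(einj g f) // inE //; exact: KL.
rewrite !inE => OG OH eqGH; apply/seteqP; split=> f.
  have [GL _ _] := OG => Gf; apply/(imE H f OH (GL _ Gf)).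
  by rewrite -eqGH; exists f.
have [HL _ _] := OH => Hf; apply/(imE G f OG (HL _ Hf)).
by rewrite eqGH; exists f.
Qed.

End Encoding.

(** * Sets of naturals and real numbers *)

Section Continuum.
Variable R : realType.
Local Open Scope ring_scope.

(** A real is determined by its Dedekind cut, a set of rationals. *)
Lemma real_card_le : ([set: R] #<= [set: set nat])%card.
Proof.
apply: (@set_inj_card_le _ _ _ _
  (fun x : R => [set k | exists2 q : rat, pickle q = k & ratr q < x])) => // x y _ _.
wlog lt_xy : x y / x < y => [H|].
  by case: (ltgtP x y) => // [/H|/[swap] /esym /[swap] /H] H' /H'.
have [q /[!in_itv]/= /andP[xq qy]] := rat_in_itvoo lt_xy.
move/seteqP=> [_ /(_ (pickle q))] [|q' /(pcan_inj pickleK) ->]; first by exists q.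
by rewrite ltNge (ltW xq).
Qed.

Implicit Types A B : set nat.

Definition ternary_sum A k : R := \sum_(i < k) `[< A i >]%:R / 3 ^+ i.
Definition ternary A : R := sup (range (ternary_sum A)).

Lemma ternary_sumS A k :
  ternary_sum A k.+1 = ternary_sum A k + `[< A k >]%:R / 3 ^+ k.
Proof. by rewrite /ternary_sum big_ord_recr. Qed.

Lemma ternary_sum_homo A : {homo ternary_sum A : k l / (k <= l)%N >-> k <= l}.
Proof.
apply: homo_leq => //= [x y z|k]; first exact: le_trans.
by rewrite ternary_sumS lerDl divr_ge0 // exprn_ge0.
Qed.

(** The term [3 / 2 / 3 ^+ k] is the sum of the geometric series of the weights from
    [k] on, hence the largest possible value of the digits not yet summed. *)
Lemma ternary_sum_tail A k l : (k <= l)%N ->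
  ternary_sum A l + 3 / 2 / 3 ^+ l <= ternary_sum A k + 3 / 2 / 3 ^+ k.
Proof.
move=> /subnKC <-; elim: (l - k)%N => [|m IH]; first by rewrite addn0.
apply: le_trans _ IH; rewrite addnS ternary_sumS exprSr invfM.
have : 0 <= (3 ^+ (k + m))^-1 :> R by rewrite invr_ge0 exprn_ge0.
by case: `[< _ >] => /=; lra.
Qed.

Lemma ternary_sum_ub A k l : ternary_sum A l <= ternary_sum A k + 3 / 2 / 3 ^+ k.
Proof.
have pos m : 0 <= 3 / 2 / 3 ^+ m :> R by rewrite !divr_ge0 // exprn_ge0.
have [kl|/ltnW lk] := leqP k l.
  by apply: le_trans (ternary_sum_tail A kl); rewrite lerDl.
by apply: (le_trans (ternary_sum_homo A lk)); rewrite lerDl.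
Qed.

Lemma le_ternary A k : ternary_sum A k <= ternary A.
Proof.
apply: ub_le_sup; last by exists k.
by exists (ternary_sum A 0 + 3 / 2 / 3 ^+ 0) => _ [l _ <-]; exact: ternary_sum_ub.
Qed.

Lemma ternary_le A k : ternary A <= ternary_sum A k + 3 / 2 / 3 ^+ k.
Proof.
apply: ge_sup; first by exists (ternary_sum A 0), 0%N.
by move=> _ [l _ <-]; exact: ternary_sum_ub.
Qed.

(** At the first difference [k], the digit 1 of [A] weighs [3 ^- k], while all the
    later digits of [B] together weigh at most half of this. *)
Lemma ternary_lt A B k : (forall i, (i < k)%N -> A i = B i) ->
  A k -> ~ B k -> ternary B < ternary A.
Proof.
move=> eqAB Ak nBk.
apply: (le_lt_trans (ternary_le B k.+1)).
apply: (lt_le_trans _ (le_ternary A k.+1)).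
have -> : ternary_sum A k.+1 = ternary_sum B k + 1 / 3 ^+ k.
  rewrite ternary_sumS asboolT //; congr (_ + _).
  by apply: eq_bigr => i _; rewrite eqAB.
rewrite ternary_sumS asboolF // exprSr invfM.
have : 0 < (3 ^+ k)^-1 :> R by rewrite invr_gt0 exprn_gt0.
by rewrite /=; lra.
Qed.

Lemma ternary_inj : injective ternary.
Proof.
move=> A B tAB; apply: contrapT => neqAB.
have diffAB : exists k, `[< A k <> B k >].
  apply: contrapT => noK; apply: neqAB; apply/funext => k.
  by apply: contrapT => kAB; apply: noK; exists k; apply/asboolP.
case: (ex_minnP diffAB) => k /asboolP kAB kmin.
have eqAB i : (i < k)%N -> A i = B i.
  by move=> ik; apply: contrapT => /asboolP /kmin; rewrite leqNgt ik.
have [Ak|nAk] := pselect (A k); have [Bk|nBk] := pselect (B k).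
- by apply: kAB; apply/propext.
- by have := ternary_lt eqAB Ak nBk; rewrite tAB ltxx.
- by have := ternary_lt (fun i ik => esym (eqAB i ik)) Bk nAk; rewrite tAB ltxx.
- by apply: kAB; apply/propext.
Qed.

Lemma card_set_nat : ([set: set nat] #= [set: R])%card.
Proof.
rewrite card_eq_le real_card_le andbT.
by apply: (@set_inj_card_le _ _ _ _ ternary) => // A B _ _; exact: ternary_inj.
Qed.

End Continuum.

Theorem theorem3p39 (n : nat) (n_ge2 : (2 <= n)%N) (Atom : Type)
    (P : set Atom) (I : set pindex) (R : realType)
    (P_fin : finite_set P) (P_neq0 : nonempty P)
    (I_fin : finite_set I)
    (I_pos : exists r : pindex, I r /\ (0 < val r)%R) :
  (@OmegaH n Atom P I #= [set: R]%classic)%card.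
Proof.
have [p Pp] := P_neq0; have [r [Ir r_gt0]] := I_pos.
apply: card_eq_trans (card_set_nat R); rewrite card_eq_le.
by rewrite OmegaH_card_le ?finite_set_countable //= (card_le_OmegaH n_ge2 Pp Ir).
Qed.
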